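(* Let $\Gamma=(\gamma_n)$ and $\Lambda=(\lambda_j)$ be two finite or infinite sequences of distinct points in $\mathbb{C}$ which are disjoint as subsets of $\mathbb{C}$, and let $v=(v_n)$ and $w=(w_j)$ be sequences of positive numbers, indexed by the same index sets as $\Gamma$ and $\Lambda$ respectively. Assume that $\Lambda\subset(\Gamma,v)^*$. If the discrete Hilbert transform $$H_v(\Gamma,\Lambda):\ \ell^2_v\to\ell^2_w,\qquad (a_n)_n\mapsto\Big(\sum_n\frac{a_nv_n}{\lambda_j-\gamma_n}\Big)_j,$$ is unitary, then $\Gamma\cup\Lambda$ is a subset of a circle or a straight line in $\mathbb{C}$.
   Context: For a sequence of positive weights $v=(v_n)$, $\ell^2_v$ denotes the Hilbert space of complex sequences $(a_n)$ with $\|(a_n)\|_v^2=\sum_n|a_n|^2v_n<\infty$; $\ell^2_w$ is defined likewise with the weights $w=(w_j)$. The set $(\Gamma,v)^*$ is $$(\Gamma,v)^*=\Big\{z\in\mathbb{C}:\ \sum_n\frac{v_n}{|z-\gamma_n|^2}<\infty\Big\},$$ where points $z\in\Gamma$ are understood not to belong to $(\Gamma,v)^*$. The assumption $\Lambda\subset(\Gamma,v)^*$ guarantees that, for $(a_n)\in\ell^2_v$, each series $\sum_n a_nv_n/(\lambda_j-\gamma_n)$ converges absolutely. ''Unitary'' means that the map takes $\ell^2_v$ into $\ell^2_w$ and is a surjective linear isometry. *)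

(* Defs.v *)
From mathcomp Require Import all_boot all_order all_algebra.
From mathcomp Require Import all_classical all_reals.
From mathcomp Require Import ereal numfun esum.
From mathcomp Require Import complex.

Set Implicit Arguments.
Unset Strict Implicit.
Unset Printing Implicit Defensive.

Import Order.TTheory GRing.Theory Num.Theory.
Import ComplexField.Normc.
Local Open Scope classical_set_scope.
Local Open Scope complex_scope.
Local Open Scope ring_scope.

(* Finite and infinite sequences are families indexed by an arbitrary
   [countType]; all the sums below are unordered, so the enumeration of the
   index type plays no role. *)

(* [normc z] is the modulus as an element of [R]; [`|z|] lives in [R[i]]. *)

Section Sums.
Variables (R : realType) (I : countType).

(* The sum of an absolutely summable real family: sum of its positive part minus
   sum of its negative part. Meaningless on other families. *)
Definition rsum (f : I -> R) : R :=
  fine (\esum_(n in [set: I]) (EFin \o f)^\+%E n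
        - \esum_(n in [set: I]) (EFin \o f)^\-%E n)%E.

Definition csum (f : I -> R[i]) : R[i] :=
  rsum (fun n => complex.Re (f n)) +i* rsum (fun n => complex.Im (f n)).

End Sums.

Section WeightedL2.
Variables (R : realType) (I : countType).

Definition l2_sqnorm (v : I -> R) (a : I -> R[i]) : \bar R :=
  (\esum_(n in [set: I]) (normc (a n) ^+ 2 * v n)%:E)%E.

Definition l2 (v : I -> R) : set (I -> R[i]) :=
  [set a | (l2_sqnorm v a < +oo)%E].

Definition l2_norm (v : I -> R) (a : I -> R[i]) : R :=
  Num.sqrt (fine (l2_sqnorm v a)).

End WeightedL2.

Section Unitary.
Variables (R : realType) (I J : countType).

(* [T] is defined on all families, but only its restriction to [l2 v]
   matters. *)
Definition unitary (v : I -> R) (w : J -> R)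
    (T : (I -> R[i]) -> (J -> R[i])) : Prop :=
  [/\ forall a, l2 v a -> l2 w (T a),
      forall (c : R[i]) a b, l2 v a -> l2 v b ->
        T (fun n => c * a n + b n) = (fun j => c * T a j + T b j),
      forall a, l2 v a -> l2_norm w (T a) = l2_norm v a
    & forall b, l2 w b -> exists2 a, l2 v a & T a = b].

End Unitary.

Section DiscreteHilbertTransform.
Variables (R : realType) (I J : countType).

(* Points of [range gamma] are excluded explicitly, because division by zero
   is total: the corresponding term of the sum would be [0]. *)
Definition gamma_star (gamma : I -> R[i]) (v : I -> R) : set R[i] :=
  [set z | ~ range gamma z /\
    (\esum_(n in [set: I]) (v n / normc (z - gamma n) ^+ 2)%:E < +oo)%E].

Definition hilbert_transform (gamma : I -> R[i]) (lambda : J -> R[i])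
    (v : I -> R) (a : I -> R[i]) : J -> R[i] :=
  fun j => csum (fun n => a n * (v n)%:C / (lambda j - gamma n)).

End DiscreteHilbertTransform.

Definition circle (R : realType) (c : R[i]) (r : R) : set R[i] :=
  [set z | normc (z - c) = r].

Definition line (R : realType) (p d : R[i]) : set R[i] :=
  [set p + t%:C * d | t in [set: R]].

(* Main.v *)
(* Put [g_j(n) = 1 / (lambda_j - gamma_n)]. Unitarity says that the functions
   [conj g_j] are orthogonal, with [H (conj g_j) = delta_j / w_j]. Fix a row [0].
   Since [g_0 g_k] is proportional to [g_k - g_0], the transform of
   [g_0 conj g_j] vanishes in all rows other than [0] and [j], so by injectivity
   [g_0 conj g_j] is a combination of [conj g_0] and [conj g_j]. Pointwise this
   says that the images [zeta] of all the points under the inversion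
   [s |-> 1 / (lambda_0 - s)] satisfy one equation
   [zeta + tau * conj zeta = kappa] with [|tau| = 1], which describes a line. *)

Require Import Defs.
From mathcomp Require Import all_boot all_order all_algebra.
From mathcomp Require Import all_classical all_reals.
From mathcomp Require Import ereal numfun esum.
From mathcomp Require Import complex.
From mathcomp Require Import ring lra.

Set Implicit Arguments.
Unset Strict Implicit.
Unset Printing Implicit Defensive.

Import Order.TTheory GRing.Theory Num.Theory.
Import ComplexField.Normc.
Local Open Scope classical_set_scope.
Local Open Scope complex_scope.
Local Open Scope ring_scope.

(** * Modulus and conjugation in [R[i]] *)

Section ComplexModulus.
Variable R : realType.
Implicit Types x y z : R[i].

Lemma normc_ge0 z : 0 <= normc z.
Proof. by case: z => a b; exact: sqrtr_ge0. Qed.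

Lemma sqr_normcE z : normc z ^+ 2 = complex.Re z ^+ 2 + complex.Im z ^+ 2.
Proof. by case: z => a b /=; rewrite sqr_sqrtr// addr_ge0 ?sqr_ge0. Qed.

Lemma sqr_normc_conj z : (normc z ^+ 2)%:C = z * z^*%C.
Proof. by rewrite -sqr_normc rmorphXn. Qed.

Lemma sqr_normcD_le x y :
  normc (x + y) ^+ 2 <= 2 * normc x ^+ 2 + 2 * normc y ^+ 2.
Proof.
rewrite !sqr_normcE; case: x => a b; case: y => c d /=.
have := sqr_ge0 (a - c); have := sqr_ge0 (b - d).
rewrite !expr2; nra.
Qed.

(** The hypothesis says that [x / y] is fixed by conjugation, hence real. *)
Lemma real_quotient_conj x y : y != 0 -> x^*%C * y = x * y^*%C ->
  exists t : R, x = t%:C * y.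
Proof.
move=> y0 xy; have yc0 : y^*%C != 0 by rewrite conjc_eq0.
have : (x / y)^*%C = x / y.
  rewrite rmorphM/= conjc_inv; apply: (mulIf y0); apply: (mulIf yc0).
  by rewrite mulrAC mulfVK// xy mulfVK.
set q := x / y => qr; exists (complex.Re q).
rewrite -[x in LHS](mulfVK y0) -/q; congr (_ * _).
case: q qr => a b [] /= /eqP; rewrite eq_sym -subr_eq0 opprK => /eqP bb.
by congr (_ +i* _); lra.
Qed.

End ComplexModulus.

(** * Sums with a single nonzero term *)

Section SingleTermSums.
Variables (R : realType) (I : countType).

Lemma rsum_single (f : I -> R) n :
  (forall m, m != n -> f m = 0) -> rsum f = f n.
Proof.
move=> f0.
have single (g : I -> \bar R) : (forall m, (0 <= g m)%E) ->
    (forall m, m != n -> g m = 0%E) -> (\esum_(m in [set: I]) g m = g n)%E.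
  move=> g0 gn; rewrite (esumID [set n])// setTI esum_set1//.
  rewrite esum1 ?adde0// => m [_ /= mn]; apply: gn; exact/eqP.
have fp m : m != n -> (EFin \o f)^\+%E m = 0%E.
  by move=> mn; rewrite funeposE /= f0// maxxx.
have fn m : m != n -> (EFin \o f)^\-%E m = 0%E.
  by move=> mn; rewrite funenegE /= f0// oppr0 maxxx.
rewrite /rsum (single _ _ fp) ?(single _ _ fn)//.
rewrite funeposE funenegE /= -!EFin_max /=.
by rewrite /Num.max; case: ltP => ?; case: ltP => ?; lra.
Qed.

Lemma csum_single (f : I -> R[i]) n :
  (forall m, m != n -> f m = 0) -> csum f = f n.
Proof.
move=> f0; rewrite /csum !(@rsum_single _ n); first by case: (f n).
all: by move=> m mn; rewrite f0.
Qed.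

End SingleTermSums.

(** * Weighted square-summable families *)

Lemma esum_le_scale (R : realType) (T : choiceType) (A : set T)
    (f g : T -> \bar R) (k : R) :
  (forall i, 0 <= g i)%E -> 0 <= k ->
  (forall i, A i -> f i <= k%:E * g i)%E ->
  (\esum_(i in A) f i <= k%:E * \esum_(i in A) g i)%E.
Proof.
move=> g0 k0 fg; rewrite ge_ereal_sup//= => _ [X [finX XA]] <-.
have : (\sum_(i \in X) f i <= k%:E * \sum_(i \in X) g i)%E.
  by rewrite ge0_mule_fsumr//; apply: lee_fsum => // i /XA; exact: fg.
move=> /le_trans; apply; apply: lee_wpmul2l; first by rewrite lee_fin.
by apply: ereal_sup_ubound; exists X.
Qed.

Section WeightedSpace.
Variables (R : realType) (I : countType) (v : I -> R).
Hypothesis v_gt0 : forall n, 0 < v n.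
Implicit Types a b : I -> R[i].

Definition delta (n : I) : I -> R[i] := fun m => (m == n)%:R.

Let term_ge0 a n : (0 <= (normc (a n) ^+ 2 * v n)%:E)%E.
Proof. by rewrite lee_fin mulr_ge0// ?exprn_ge0 ?normc_ge0// ltW. Qed.

Lemma l2_sqnorm_ge0 a : (0 <= l2_sqnorm v a)%E.
Proof. exact: esum_ge0. Qed.

Lemma l2_fin_num a : l2 v a -> l2_sqnorm v a \is a fin_num.
Proof. by move=> la; rewrite ge0_fin_numE// l2_sqnorm_ge0. Qed.

Lemma l2_sqnorm_split n a : l2_sqnorm v a =
  ((normc (a n) ^+ 2 * v n)%:E +
   \esum_(m in ~` [set n]) (normc (a m) ^+ 2 * v m)%:E)%E.
Proof. by rewrite /l2_sqnorm (esumID [set n])// !setTI esum_set1. Qed.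

Lemma l2_comb (c : R[i]) a b :
  l2 v a -> l2 v b -> l2 v (fun n => c * a n + b n).
Proof.
move=> la lb; rewrite /l2/=.
(* Dominates both coefficients [2 * normc c ^+ 2] and [2] produced by [sqr_normcD_le]. *)
pose k := 2 * normc c ^+ 2 + 2.
have k0 : 0 <= k by rewrite addr_ge0// mulr_ge0// sqr_ge0.
have : (k%:E * (l2_sqnorm v a + l2_sqnorm v b) < +oo)%E.
  by rewrite -(fineK (l2_fin_num la)) -(fineK (l2_fin_num lb)) -EFinD -EFinM ltry.
apply: le_lt_trans; rewrite /l2_sqnorm -esumD//.
apply: esum_le_scale => // n; first exact: adde_ge0.
move=> _.
rewrite -EFinD -EFinM lee_fin -mulrDl mulrA ler_wpM2r ?(ltW (v_gt0 n))//.
apply: le_trans (sqr_normcD_le _ _) _; rewrite normcM exprMn /k.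
have := sqr_ge0 (normc c); have := sqr_ge0 (normc (a n)).
have := sqr_ge0 (normc (b n)); nra.
Qed.

Lemma l2_sqnorm0 : l2_sqnorm v (fun=> 0) = 0%E.
Proof. by apply: esum1 => n _; rewrite normc0 expr0n mul0r. Qed.

Lemma l2_cst0 : l2 v (fun=> 0).
Proof. by rewrite /l2/= l2_sqnorm0 ltry. Qed.

Lemma l2_eq0 a : l2 v a -> l2_norm v a = 0 -> forall n, a n = 0.
Proof.
move=> la /eqP; rewrite sqrtr_eq0 => a0 n; apply: eq0_normc.
have : (l2_sqnorm v a <= 0)%E by rewrite -(fineK (l2_fin_num la)) lee_fin.
rewrite (l2_sqnorm_split n) => /(le_trans (leeDl _ (esum_ge0 _))) le0.
have {}le0 : normc (a n) ^+ 2 * v n <= 0 by rewrite -lee_fin le0.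
apply/eqP; rewrite -sqrf_eq0 eq_le sqr_ge0 andbT.
by rewrite -(pmulr_lle0 _ (v_gt0 n)).
Qed.

(** Only the term at [n] changes and the finite tail cancels. Expanding the square of the modulus
    then exposes the real part of an inner product with a coordinate vector. *)
Lemma fine_l2_bump (c : R[i]) n b : l2 v b ->
  let cb := fun m => c * delta n m + b m in
  l2 v cb /\ fine (l2_sqnorm v cb) =
    fine (l2_sqnorm v b) + (normc (c + b n) ^+ 2 - normc (b n) ^+ 2) * v n.
Proof.
move=> lb cb.
have tail : (\esum_(m in ~` [set n]) (normc (cb m) ^+ 2 * v m)%:E =
    \esum_(m in ~` [set n]) (normc (b m) ^+ 2 * v m)%:E)%E.
  by apply: eq_esum => m /eqP /negPf mn; rewrite /cb /delta mn mulr0 add0r.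
have cbn : cb n = c + b n by rewrite /cb /delta eqxx mulr1.
have := l2_fin_num lb; rewrite (l2_sqnorm_split n) fin_numD => /andP[_ tb].
rewrite /l2/= !(l2_sqnorm_split n) tail cbn -(fineK tb) -!EFinD; split.
  by rewrite ltry.
by rewrite /=; ring.
Qed.

Lemma l2_delta n : l2 v (delta n).
Proof.
have [+ _] := fine_l2_bump 1 n l2_cst0; congr l2.
by apply/funext => m; rewrite mul1r addr0.
Qed.

Lemma fine_l2_scale_delta (c : R[i]) n :
  fine (l2_sqnorm v (fun m => c * delta n m)) = normc c ^+ 2 * v n.
Proof.
have [_] := fine_l2_bump c n l2_cst0.
rewrite normc0 addr0 expr0n subr0 => E.
transitivity (fine (l2_sqnorm v (fun=> 0)) + normc c ^+ 2 * v n).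
  by rewrite -E; congr (fine (l2_sqnorm _ _)); apply/funext => m; rewrite addr0.
by rewrite l2_sqnorm0 add0r.
Qed.

End WeightedSpace.

(** * Abstract unitary maps *)

Section UnitaryTransform.
Variables (R : realType) (I J : countType).
Variables (v : I -> R) (w : J -> R) (T : (I -> R[i]) -> J -> R[i]).
Hypotheses (v_gt0 : forall n, 0 < v n) (w_gt0 : forall j, 0 < w j).
Hypothesis T_unitary : unitary v w T.

Lemma unitary_inj a b : l2 v a -> l2 v b -> T a = T b -> a = b.
Proof.
have [_ Tlin Tiso _] := T_unitary; move=> la lb Tab.
pose d n := -1 * a n + b n; have ld : l2 v d by exact: l2_comb.
have Td : T d = fun=> 0.
  by rewrite /d Tlin// Tab; apply/funext => j; rewrite mulN1r addNr.
apply/funext => n; apply/esym/eqP; rewrite -subr_eq0 addrC -mulN1r.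
apply/eqP; apply: (l2_eq0 v_gt0 ld).
by rewrite -Tiso// Td /l2_norm l2_sqnorm0 sqrtr0.
Qed.

Lemma unitary_sqnorm a : l2 v a ->
  fine (l2_sqnorm w (T a)) = fine (l2_sqnorm v a).
Proof.
have [_ _ Tiso _] := T_unitary => la; have /eqP := Tiso a la.
by rewrite eqr_sqrt ?fine_ge0 ?l2_sqnorm_ge0// => /eqP.
Qed.

Lemma unitary_scale (c : R[i]) a : l2 v a ->
  l2 v (fun n => c * a n) /\ T (fun n => c * a n) = (fun j => c * T a j).
Proof.
have [_ Tlin _ _] := T_unitary; move=> la; have l0 := l2_cst0 v.
(* Linearity is available only for combinations [c * a + b], so the value at zero comes from
   [0 = -1 * 0 + 0]. *)
have T0 : T (fun=> 0) = fun=> 0.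
  have E : (fun=> 0) = (fun n : I => -1 * 0 + 0) :> (I -> R[i]).
    by apply/funext => n; rewrite mulr0 addr0.
  by rewrite E Tlin//; apply/funext => j; rewrite mulN1r addNr.
have E : (fun n => c * a n) = (fun n => c * a n + 0).
  by apply/funext => n; rewrite addr0.
split; first by rewrite E; exact: l2_comb.
by rewrite E Tlin// T0; apply/funext => j; rewrite addr0.
Qed.

(* Both [c T(delta n) + delta j] and [c delta n + u] are perturbations at a
   single coordinate, so polarization needs no inner product. *)
Lemma unitary_preimage_delta u n j : l2 v u -> T u = delta R j ->
  u n * (v n)%:C = (T (delta R n) j)^*%C * (w j)%:C.
Proof.
have [Tl2 Tlin _ _] := T_unitary; move=> lu Tu.
have ln : l2 v (delta R n) by exact: l2_delta.
set h := T (delta R n); have lh : l2 w h by exact: Tl2.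
have key (c : R[i]) :
    (normc (c + u n) ^+ 2 - normc (u n) ^+ 2 - normc c ^+ 2) * v n =
    (normc (1 + c * h j) ^+ 2 - normc (c * h j) ^+ 2 - 1) * w j.
  have [lc sc] := fine_l2_bump v_gt0 c n lu.
  have [lcd Tcd] := unitary_scale c ln.
  have lch : l2 w (fun k => c * h k) by rewrite -Tcd; exact: Tl2.
  have [_ sd] := fine_l2_bump w_gt0 1 j lch.
  have Tc : T (fun m => c * delta R n m + u m) =
      (fun k => 1 * delta R j k + c * h k).
    by rewrite Tlin// Tu; apply/funext => k; rewrite mul1r addrC.
  have := unitary_sqnorm lc; rewrite Tc sd sc -Tcd !unitary_sqnorm//.
  rewrite fine_l2_scale_delta// -(unitary_sqnorm lu) Tu.
  have := fine_l2_scale_delta w_gt0 1 j.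
  rewrite (_ : (fun m => _) = delta R j); last first.
    by apply/funext => k; rewrite mul1r.
  by move=> ->; rewrite normc1; lra.
(* Up to a factor 2, [key c] equates the real parts of [c^* * u n * v n] and [c * h j * w j]; the
   values 1 and i of [c] give the real and imaginary parts of the claim. *)
have := key 1; have := key 'i%C.
rewrite !sqr_normcE; case: (u n) => a b; case: (h j) => c d /=.
rewrite !(mul0r, mul1r, add0r, addr0, sub0r).
move=> k1 ki; congr (_ +i* _); rewrite ?(mulr0, subr0, addr0, mul0r, add0r).
all: nra.
Qed.

End UnitaryTransform.

(** * Inversion of lines *)

(** The inverted points lie on a line. If it passes through 0 ([kappa = 0]), its preimage is a line
    through [p0]; otherwise it is a circle through [p0]. *)
Lemma inversion_circle_line (R : realType) (S : set R[i])
    (p0 s0 tau kappa : R[i]) :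
  S s0 -> s0 != p0 -> tau * tau^*%C = 1 ->
  (forall s, S s -> s != p0 ->
    (p0 - s)^-1 + tau * ((p0 - s)^-1)^*%C = kappa) ->
  (exists (c : R[i]) (r : R), 0 < r /\ S `<=` circle c r) \/
  (exists p d : R[i], d != 0 /\ S `<=` line p d).
Proof.
move=> Ss0 s0p tau1 Skappa.
have q0 : p0 - s0 != 0 by rewrite subr_eq0 eq_sym.
have tau0 : tau != 0.
  by apply: contra_eq_neq tau1 => ->; rewrite mul0r eq_sym oner_eq0.
have [kappa0|kappa0] := eqVneq kappa 0.
  right; exists p0, (p0 - s0); split => // s Ss.
  have [->|sp] := eqVneq s p0; first by exists 0 => //; rewrite mul0r addr0.
  have q : p0 - s != 0 by rewrite subr_eq0 eq_sym.
  (* Conjugation multiplies every [p0 - x] by the same factor [- tau], so the quotients of these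
     differences are real. *)
  have conjq x : S x -> x != p0 -> (p0 - x)^*%C = - tau * (p0 - x).
    move=> Sx xp; have x0 : p0 - x != 0 by rewrite subr_eq0 eq_sym.
    have xc0 : (p0 - x)^*%C != 0 by rewrite conjc_eq0.
    have := Skappa x Sx xp; rewrite kappa0 conjc_inv => E.
    rewrite -[LHS]mul1r -(mulfV x0).
    have -> : (p0 - x)^-1 = - (tau / (p0 - x)^*%C).
      by apply/eqP; rewrite -addr_eq0 E.
    by rewrite mulrN mulNr mulrA mulfVK// mulNr mulrC.
  have [t qt] : exists t : R, p0 - s = t%:C * (p0 - s0).
    by apply: real_quotient_conj; rewrite ?conjq//; ring.
  exists (- t) => //; rewrite rmorphN/= mulNr -qt; ring.
left; exists (p0 - kappa^-1), (normc kappa)^-1.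
have nk : 0 < normc kappa.
  rewrite lt_neqAle normc_ge0 andbT eq_sym.
  by apply: contra_neq kappa0; exact: eq0_normc.
split; first by rewrite invr_gt0.
(* Conjugate the equation at [s0], multiply by [tau] and use [tau * tau^* = 1]. *)
have conjk : kappa^*%C * tau = kappa.
  rewrite -(Skappa _ Ss0 s0p); set z := _^-1.
  rewrite rmorphD rmorphM /= conjcK mulrDl mulrAC [tau^*%C * _]mulrC tau1 mul1r.
  by rewrite addrC [z^*%C * _]mulrC.
move=> s Ss; rewrite /circle/= -normcV.
apply/eqP; rewrite -(eqrXn2 (isT : (0 < 2)%N)) ?normc_ge0//.
apply/eqP/complexI; rewrite !sqr_normc_conj.
have [->|sp] := eqVneq s p0.
  by have -> : p0 - (p0 - kappa^-1) = kappa^-1 by ring.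
have := Skappa _ Ss sp; set q := p0 - s.
have q_neq0 : q != 0 by rewrite subr_eq0 eq_sym.
have qc_neq0 : q^*%C != 0 by rewrite conjc_eq0.
have -> : s - (p0 - kappa^-1) = kappa^-1 - q by rewrite /q; ring.
move: q q_neq0 qc_neq0 => q q_neq0 qc_neq0.
have kc_neq0 : kappa^*%C != 0 by rewrite conjc_eq0.
rewrite rmorphB/= !conjc_inv => E.
(* Clearing denominators and using [conjk] gives the expansion of
   [|kappa^-1 - q|^2 = |kappa^-1|^2]. *)
have {E} : q^*%C + tau * q = kappa * (q * q^*%C) by rewrite -E; field; exact/andP.
rewrite -[in RHS]conjk => E.
have {}E : kappa^*%C^-1 * q^*%C / tau + kappa^*%C^-1 * q = q * q^*%C.
  apply: (mulfI (mulf_neq0 kc_neq0 tau0)); rewrite -E; field; exact/andP.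
have ik : kappa^-1 = kappa^*%C^-1 / tau by rewrite -[in LHS]conjk invfM mulrC.
rewrite [in LHS]mulrBr !mulrBl -E ik; ring.
Qed.

(** * Kernels of a unitary discrete Hilbert transform *)

Section DiscreteHilbert.
Variables (R : realType) (I J : countType).
Variables (gamma : I -> R[i]) (lambda : J -> R[i]) (v : I -> R) (w : J -> R).
Hypothesis lambda_inj : injective lambda.
Hypothesis disj : forall j n, lambda j != gamma n.
Hypotheses (v_gt0 : forall n, 0 < v n) (w_gt0 : forall j, 0 < w j).
Local Notation H := (hilbert_transform gamma lambda v).
Hypothesis H_unitary : unitary v w H.

(** Conjugated so that the [j]-th entry of [H a] is the inner product of [a] with this vector in the
    weighted space. *)
Definition conj_kernel (j : J) : I -> R[i] :=
  fun n => ((lambda j - gamma n)^-1)^*%C.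

Let diff0 j n : lambda j - gamma n != 0.
Proof. by rewrite subr_eq0. Qed.

Let realC_neq0 (x : R) : 0 < x -> x%:C != 0 :> R[i].
Proof. by move=> x0; rewrite fmorph_eq0 gt_eqF. Qed.

Lemma conj_kernel_neq0 j n : conj_kernel j n != 0.
Proof. by rewrite conjc_eq0 invr_eq0. Qed.

Lemma hilbert_delta n j : H (delta R n) j = (v n)%:C / (lambda j - gamma n).
Proof.
rewrite /hilbert_transform (@csum_single _ _ _ n) /delta ?eqxx ?mul1r//.
by move=> m /negPf ->; rewrite mul0r mul0r.
Qed.

(** By surjectivity [delta j] has a preimage [u], and [unitary_preimage_delta] identifies [u] with
    [w j] times the kernel. Both claims follow. *)
Lemma hilbert_conj_kernel j : l2 v (conj_kernel j) /\
  H (conj_kernel j) = fun k => (w j)%:C^-1 * delta R j k.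
Proof.
have [_ _ _ surj] := H_unitary.
have [u lu Hu] := surj _ (l2_delta w_gt0 j).
have wj := realC_neq0 (w_gt0 j).
have -> : conj_kernel j = fun n => (w j)%:C^-1 * u n.
  apply/funext => n; have vn := realC_neq0 (v_gt0 n).
  have := unitary_preimage_delta v_gt0 w_gt0 H_unitary n lu Hu.
  have -> : (H (delta R n) j)^*%C = (v n)%:C * conj_kernel j n.
    by rewrite hilbert_delta rmorphM; congr (_ * _); exact: conjc_real.
  move=> E; apply: (mulIf vn).
  by rewrite -mulrA E [_ * (w j)%:C]mulrC mulKf// mulrC.
by have [lwu ->] := unitary_scale v_gt0 H_unitary (w j)%:C^-1 lu; rewrite Hu.
Qed.

(* The entries of [p] in every row [k != j0] are known by partial fractions, so
   [H p] lies in the span of [H (conj_kernel j0)] and [H (conj_kernel j)]. *)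
Lemma kernel_relation j0 j : j != j0 -> exists kappa : R[i], forall n,
  conj_kernel j n / (lambda j0 - gamma n) =
  kappa * conj_kernel j0 n + (lambda j0 - lambda j)^-1 * conj_kernel j n.
Proof.
move=> jj0; have [_ Hlin _ _] := H_unitary.
have d0 k : k != j0 -> lambda j0 - lambda k != 0.
  by move=> kj0; rewrite subr_eq0 eq_sym; apply: contra_neq kj0 => /lambda_inj.
have [l0 H0] := hilbert_conj_kernel j0; have [lj Hj] := hilbert_conj_kernel j.
pose p n := conj_kernel j n / (lambda j0 - gamma n).
(* Conjugating one factor keeps the modulus: [p] has the same moduli as the product of the two
   conjugate kernels, which is a multiple of their difference. *)
have lp : l2 v p.
  pose z := (lambda j0 - lambda j)^-1^*%C.
  have [lz _] := unitary_scale v_gt0 H_unitary (- z) l0.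
  have := l2_comb v_gt0 z lj lz; rewrite /l2/=; congr (_ < _)%E.
  apply: eq_esum => n _; congr (_ ^+ 2 * _)%:E.
  have -> : z * conj_kernel j n + - z * conj_kernel j0 n =
      conj_kernel j n * conj_kernel j0 n.
    rewrite /z /conj_kernel -rmorphN -!rmorphM -rmorphD /=; congr (_^*%C).
    by field; rewrite !diff0 d0.
  rewrite /p !normcM; congr (_ * _); rewrite /conj_kernel.
  by case: (_^-1) => a b /=; rewrite sqrrN.
have Hp k : k != j0 -> H p k = (lambda j0 - lambda k)^-1 * H (conj_kernel j) k.
  move=> kj0; set c := - (lambda j0 - lambda k).
  (* Since [1 - (lambda j0 - lambda k) / (lambda j0 - gamma n)] equals [(lambda k - gamma n) /
     (lambda j0 - gamma n)], row [k] here agrees termwise with row [j0] of [H (conj_kernel j)],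
     which is 0. *)
  have : H (fun n => c * p n + conj_kernel j n) k = H (conj_kernel j) j0.
    rewrite /hilbert_transform; congr csum; apply/funext => n.
    by rewrite /p /c; move: (conj_kernel j n) => u; field; rewrite !diff0.
  rewrite (Hlin c p _ lp lj) Hj /delta (eq_sym j0) (negPf jj0) mulr0 => E.
  have -> : H p k = c^-1 * (c * H p k).
    by rewrite mulKf// oppr_eq0 d0.
  move/eqP: E; rewrite addr_eq0 => /eqP ->; rewrite /c invrN mulrNN//.
(* Chosen to match row [j0], where [H (conj_kernel j0)] is [(w j0)^-1]. *)
exists (H p j0 * (w j0)%:C) => n.
set kappa := _ * _%:C; set z := (_ - lambda j)^-1.
have [lz Hz] := unitary_scale v_gt0 H_unitary z lj.
suff : p = fun n => kappa * conj_kernel j0 n + z * conj_kernel j n.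
  by move=> pE; exact: (congr1 (@^~ n) pE).
apply: (unitary_inj v_gt0 H_unitary lp); first exact: l2_comb.
rewrite (Hlin kappa _ _ l0 lz) Hz H0; apply/funext => k.
have [->|kj0] := eqVneq k j0.
  rewrite Hj /delta eqxx (eq_sym j0) (negPf jj0) !mulr0 addr0 mulr1.
  rewrite /kappa mulfK//.
  exact: realC_neq0.
rewrite Hp// Hj /delta (negPf kj0) !mulr0 add0r.
by have [->|_] := eqVneq k j; rewrite ?mulr0.
Qed.

(* Dividing [kernel_relation] by [conj_kernel j n] gives
   [zeta - z = - tau * conj (zeta - z)] with [tau = kappa * conj z^-1]. *)
Lemma inverted_reflection j0 j (n0 : I) : j != j0 ->
  let z := (lambda j0 - lambda j)^-1 in
  exists tau : R[i], tau * tau^*%C = 1 /\ forall n,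
    let zeta := (lambda j0 - gamma n)^-1 in
    zeta + tau * zeta^*%C = z + tau * z^*%C.
Proof.
move=> jj0 z; have [kappa kappaE] := kernel_relation jj0.
have q0 : lambda j0 - lambda j != 0.
  by rewrite subr_eq0 eq_sym; apply: contra_neq jj0 => /lambda_inj.
pose x n := (lambda j0 - gamma n)^-1 - z.
have xE n : x n = - ((lambda j - gamma n) * z / (lambda j0 - gamma n)).
  by rewrite /x /z; field; rewrite diff0 q0.
pose tau := kappa * (lambda j0 - lambda j)^*%C.
have x_refl n : x n = - tau * (x n)^*%C.
  have e0 : conj_kernel j n != 0 by exact: conj_kernel_neq0.
  apply: (mulfI e0); rewrite mulrBr kappaE [_ * z]mulrC addrK.
  rewrite [in RHS]xE rmorphN !rmorphM /= -/(conj_kernel j0 n) /tau /z conjc_inv.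
  have -> : conj_kernel j n = ((lambda j - gamma n)^*%C)^-1 by exact: conjc_inv.
  have := conjc_eq0 (lambda j0 - lambda j).
  have := conjc_eq0 (lambda j - gamma n).
  rewrite (negPf q0) (negPf (diff0 j n)).
  move: (_^*%C) (_^*%C) (conj_kernel _ _) => A B C /negbT A0 /negbT B0.
  by field; rewrite A0 B0.
(* Applying [x_refl] twice gives [x n0 = tau * tau^* * x n0], so one nonzero value forces [tau] onto
   the unit circle. *)
have x_neq0 : x n0 != 0.
  by rewrite xE oppr_eq0 !mulf_neq0 ?invr_eq0 ?diff0.
exists tau; split => [|n /=].
  apply: (mulIf x_neq0); rewrite mul1r.
  have xc : (x n0)^*%C = - tau^*%C * x n0.
    by rewrite [in LHS]x_refl mulNr rmorphN rmorphM /= conjcK mulNr.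
  by rewrite [in RHS]x_refl xc mulrA mulrNN.
have xc : (x n)^*%C = ((lambda j0 - gamma n)^-1)^*%C - z^*%C by exact: rmorphB.
have /eqP := x_refl n; rewrite xc -subr_eq0 => /eqP E.
apply/eqP; rewrite -subr_eq0 -E /x; apply/eqP.
move: (_^*%C) (z^*%C) => A B; ring.
Qed.

(** * Few rows or columns *)

(** With one row the target is one-dimensional, so by injectivity [delta n] is a multiple of
    [conj_kernel j0], which vanishes nowhere. *)
Lemma row_unique_col (j0 : J) : (forall j, j = j0) -> forall n m : I, n = m.
Proof.
move=> allj n m; have [l0 H0] := hilbert_conj_kernel j0.
pose c := H (delta R n) j0 * (w j0)%:C.
have [lc Hc] := unitary_scale v_gt0 H_unitary c l0.
have E : delta R n = fun k => c * conj_kernel j0 k.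
  apply: (unitary_inj v_gt0 H_unitary) => //; first exact: l2_delta.
  rewrite Hc H0; apply/funext => j; rewrite (allj j) /delta eqxx mulr1 mulfK//.
  exact: realC_neq0.
have c0 : c != 0.
  rewrite mulf_neq0 ?realC_neq0// hilbert_delta.
  by rewrite mulf_neq0 ?invr_eq0 ?realC_neq0.
have [->//|mn] := eqVneq m n.
have /eqP := congr1 (@^~ m) E; rewrite /delta (negPf mn).
by rewrite eq_sym mulf_eq0 (negPf c0) (negPf (conj_kernel_neq0 _ _)).
Qed.

(** With at most one column the two kernels would be proportional, yet their transforms are
    supported on different rows. *)
Lemma two_rows_two_cols (j0 j1 : J) : j1 != j0 -> exists n m : I, n != m.
Proof.
move=> j10; apply: contrapT => noI.
have allI (n m : I) : n = m.
  by apply/eqP; apply: contrapT => /negP nm; apply: noI; exists n, m.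
have [c E] : exists c, conj_kernel j0 = fun n => c * conj_kernel j1 n.
  have [[n _]|non] := pselect (exists n : I, True); last first.
    by exists 0; apply/funext => n; case: non; exists n.
  exists (conj_kernel j0 n / conj_kernel j1 n); apply/funext => m.
  by rewrite (allI m n) mulfVK// conj_kernel_neq0.
have [l1 H1] := hilbert_conj_kernel j1; have [_ H0] := hilbert_conj_kernel j0.
have [_] := unitary_scale v_gt0 H_unitary c l1; rewrite -E H0 H1.
move=> /(congr1 (@^~ j0)) /eqP; rewrite /delta eqxx (eq_sym j0) (negPf j10).
by rewrite !mulr0 mulr1 invr_eq0 (negPf (realC_neq0 _)).
Qed.

Lemma no_row_no_col : (J -> False) -> I -> False.
Proof.
move=> noJ n; have : delta R n = fun=> 0.
  apply: (unitary_inj v_gt0 H_unitary); [exact: l2_delta|exact: l2_cst0|].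
  by apply/funext => j; case: (noJ j).
by move=> /(congr1 (@^~ n)) /eqP; rewrite /delta eqxx oner_eq0.
Qed.

End DiscreteHilbert.

(** * Circle or line through all the points *)

Theorem theorem1 (R : realType) (I J : countType)
    (gamma : I -> R[i]) (lambda : J -> R[i]) (v : I -> R) (w : J -> R)
    (gamma_inj : injective gamma) (lambda_inj : injective lambda)
    (disj : range gamma `&` range lambda = set0)
    (v_gt0 : forall n, 0 < v n) (w_gt0 : forall j, 0 < w j)
    (lambda_star : range lambda `<=` gamma_star gamma v)
    (H_unitary : unitary v w (hilbert_transform gamma lambda v)) :
  (exists (c : R[i]) (r : R),
     0 < r /\ range gamma `|` range lambda `<=` circle c r) \/
  (exists p d : R[i],
     d != 0 /\ range gamma `|` range lambda `<=` line p d).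
Proof.
have lg j n : lambda j != gamma n.
  apply/eqP => E; suff : set0 (gamma n) by [].
  by rewrite -disj; split; [exists n|exists j].
have [[j0 _]|exJ] := pselect (exists j : J, True); last first.
  right; exists 0, 1; split; first exact: oner_neq0.
  have noJ : J -> False by move=> j; apply: exJ; exists j.
  move=> x [[n _ _]|[j _ _]]; last by case: (noJ j).
  by case: (no_row_no_col v_gt0 H_unitary noJ n).
(* A single row leaves at most one column, hence at most two points, which lie on a line. *)
have [[j1 j10]|allj] := pselect (exists j, j != j0); last first.
  have {}allj j : j = j0.
    by apply/eqP; apply: contrapT => /negP ?; apply: allj; exists j.
  have alln := row_unique_col lg v_gt0 w_gt0 H_unitary allj.
  right; exists (lambda j0).
  have onl d : line (lambda j0) d (lambda j0).
    by exists 0 => //; rewrite mul0r addr0.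
  have [[n _]|noI] := pselect (exists n : I, True).
    exists (gamma n - lambda j0); split; first by rewrite subr_eq0 eq_sym.
    move=> _ [[m _ <-]|[j _ <-]]; last by rewrite (allj j).
    by exists 1 => //; rewrite mul1r (alln m n) addrC subrK.
  exists 1; split; first exact: oner_neq0.
  move=> _ [[m _ <-]|[j _ <-]]; last by rewrite (allj j).
  by case: noI; exists m.
have [n [m nm]] := two_rows_two_cols lg v_gt0 w_gt0 H_unitary j10.
pose zeta k := (lambda j0 - gamma k)^-1; pose z j := (lambda j0 - lambda j)^-1.
have refl j : j != j0 -> exists tau : R[i], tau * tau^*%C = 1 /\ forall k,
    zeta k + tau * (zeta k)^*%C = z j + tau * (z j)^*%C.
  exact: (inverted_reflection lambda_inj lg v_gt0 w_gt0 H_unitary n).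
have [tau [tau1 reflt]] := refl j1 j10.
(* The reflection equations at the two distinct columns [n] and [m] determine [tau], so every row
   [j != j0] yields the same [tau] and the same line. *)
have zeta_nm : (zeta n)^*%C - (zeta m)^*%C != 0.
  rewrite subr_eq0 (inj_eq (can_inj (@conjcK R))) (inj_eq invr_inj).
  by rewrite (inj_eq (addrI _)) eqr_opp (inj_eq gamma_inj).
have tau_nm t : zeta n + t * (zeta n)^*%C = zeta m + t * (zeta m)^*%C ->
    t * ((zeta n)^*%C - (zeta m)^*%C) = zeta m - zeta n.
  move=> E; rewrite mulrBr; apply/eqP; rewrite subr_eq addrAC -E.
  by rewrite addrAC subrr add0r.
have same_tau j k : j != j0 ->
    zeta k + tau * (zeta k)^*%C = z j + tau * (z j)^*%C.
  move=> jj0; have [t [_ reflj]] := refl j jj0.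
  suff -> : tau = t by [].
  by apply: (mulIf zeta_nm); rewrite !tau_nm ?reflt ?reflj.
(* The centre of inversion is [lambda j0]; [gamma n] is the required point distinct from it. *)
apply: (@inversion_circle_line _ _ (lambda j0) (gamma n) tau
  (zeta n + tau * (zeta n)^*%C)) => //.
- by left; exists n.
- by rewrite eq_sym.
- move=> _ [[k _ <-]|[j _ <-]] sj; first by rewrite reflt -/(zeta k) reflt.
  by rewrite (same_tau j)//; apply: contra_neq sj => ->.
Qed.
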